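(* Let $\mathbf A\in\mathfrak R^{N\times N}$, $\mathbf B\in\mathfrak R^{N\times q}$, $\mathbf C\in\mathfrak R^{p\times N}$, $\mathbf D\in\mathfrak R^{p\times q}$. Assume that the realization \[ \mathscr H(\zeta,0)=\mathbf D(0)+\zeta\,\mathbf C(0)(I_N-\zeta\mathbf A(0))^{-1}\mathbf B(0) \] is controllable (resp. minimal). Then the realization \[ \mathscr H(\zeta)=\mathbf D+\zeta\,\mathbf C(I_N-\zeta\mathbf A)^{-1}\mathbf B \] is $\mathfrak R$-controllable (resp. $\mathfrak R$-minimal).
   Context: Let $\ell$ be the set of sequences $\alpha=(\alpha_1,\alpha_2,\ldots)$ with entries in $\{0,1,2,\ldots\}$ and only finitely many non-zero entries. For $\alpha\in\ell$ put $z^\alpha=z_1^{\alpha_1}z_2^{\alpha_2}\cdots$ (countably many complex variables $z=(z_1,z_2,\ldots)$) and $(2\mathbb N)^{c\alpha}=\prod_{j\ge1}(2j)^{c\alpha_j}$ for $c\in\mathbb Z$. The ring $\mathfrak R$ is the image of the Kondratiev space $S_{-1}$ under the Hermite transform, i.e. the set of power series $\sum_{\alpha\in\ell}f_\alpha z^\alpha$, $f_\alpha\in\mathbb C$, such that $\sum_{\alpha\in\ell}|f_\alpha|^2(2\mathbb N)^{-k\alpha}<\infty$ for some $k\in\{1,2,\ldots\}$; it is a commutative ring (an integral domain containing $\mathbb C$ as the constant series) under the usual addition and multiplication of power series. The constant coefficient of $\mathbf F\in\mathfrak R$ is denoted $\mathbf F(0)$ (entrywise for matrices). For $\zeta\in\mathbb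 C$ with $\det(I_N-\zeta\mathbf A(0))\ne0$ the matrix $I_N-\zeta\mathbf A$ is invertible in $\mathfrak R^{N\times N}$; identities ''$\equiv$'' below are understood for all such $\zeta$. Over $\mathbb C$: a realization $D+\zeta C(I_N-\zeta A)^{-1}B$ is controllable if the columns of $\begin{pmatrix}B&AB&\cdots&A^{N-1}B\end{pmatrix}$ generate $\mathbb C^N$, observable if $f\mapsto(Cf,CAf,CA^2f,\ldots)$ is injective on $\mathbb C^N$, and minimal if it is both controllable and observable. Over $\mathfrak R$: the realization $\mathbf D+\zeta\mathbf C(I_N-\zeta\mathbf A)^{-1}\mathbf B$ is observable if the map $\mathbf f\mapsto(\mathbf C\mathbf f,\mathbf C\mathbf A\mathbf f,\mathbf C\mathbf A^2\mathbf f,\ldots)$ from $\mathfrak R^N$ into $(\mathfrak R^p)^{\mathbb N}$ is injective. It is called $\mathfrak R$-controllable if, for $\mathbf f\in\mathfrak R^{1\times N}$, the identity $\mathbf f(I_N-\zeta\mathbf A)^{-1}\mathbf B\equiv0$ (in $\mathfrak R^{1\times q}$) implies $\mathbf f=0$. It is called $\mathfrak R$-minimal if it is both observable and $\mathfrak R$-controllable. *)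

(* Defs.v *)
From HB Require Import structures.
From mathcomp Require Import all_boot all_order all_algebra finmap.
From mathcomp Require Import boolp classical_sets functions cardinality fsbigop.
From mathcomp Require Import reals constructive_ereal ereal esum complex.
From mathcomp Require Import zify ring lra.

Set Implicit Arguments.
Unset Strict Implicit.
Unset Printing Implicit Defensive.

Import Order.TTheory GRing.Theory Num.Theory.
Import ComplexField.Normc.
Local Open Scope classical_set_scope.
Local Open Scope ring_scope.

(* Multi-indices; the entry of index [j] is the exponent of z_(j+1). *)
Notation ell := {fsfun nat -> nat with 0%N}.

(* (2N)^(c alpha); indices start at 0, hence the factor 2 (j + 1). *)
Definition wt {R : realType} (c : int) (a : ell) : R :=
  \prod_(j <- finsupp a) (j.+1.*2%:R : R) ^ (c * (a j)%:Z).

Definition antidiag (a : ell) : set (ell * ell) :=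
  [set p : ell * ell | forall j, (p.1 j + p.2 j)%N = a j].

Definition kondratiev {R : realType} (f : ell -> R[i]) : Prop :=
  exists2 k : nat, (1 <= k)%N &
    (\esum_(a in [set: ell]) (normc (f a) ^+ 2 * wt (- k%:Z) a)%:E < +oo)%E.

Definition psmul {R : realType} (f g : ell -> R[i]) (a : ell) : R[i] :=
  \sum_(p \in antidiag a) f p.1 * g p.2.

Definition psconst {R : realType} (z : R[i]) (a : ell) : R[i] :=
  if a == [fsfun] then z else 0.

Section Indices.
Implicit Types a b c : ell.

Lemma ell_ext a b : (forall j, a j = b j) -> a = b.
Proof. by move=> h; apply/fsfunP. Qed.

Lemma eadd_subproof a b : {c : ell | forall j, c j = (a j + b j)%N}.
Proof.
exists [fsfun j in (finsupp a `|` finsupp b)%fset => (a j + b j)%N] => j.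
by rewrite fsfunE inE; case: finsuppP => //= _; case: finsuppP => //=.
Qed.

Definition eadd a b : ell := sval (eadd_subproof a b).

Lemma eaddE a b j : eadd a b j = (a j + b j)%N.
Proof. exact: (svalP (eadd_subproof a b)). Qed.

Lemma ell0E j : ([fsfun] : ell) j = 0%N.
Proof. by rewrite fsfunE. Qed.

Lemma antidiagP a p : antidiag a p <-> a = eadd p.1 p.2.
Proof.
split=> [h|-> j]; last by rewrite eaddE.
by apply: ell_ext => j; rewrite eaddE h.
Qed.

Definition edec n m (g : {ffun 'I_n -> 'I_m.+1}) : ell :=
  [fsfun j in seq_fset tt (iota 0 n) =>
     if insub j is Some i then (g i : nat) else 0%N].

Definition eenc n m a : {ffun 'I_n -> 'I_m.+1} := [ffun j => inord (a (j : 'I_n))].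

Lemma eencK n m a : (forall j, (n <= j)%N -> a j = 0%N) ->
  (forall j, (a j <= m)%N) -> edec (eenc n m a) = a.
Proof.
move=> h0 hm; apply: ell_ext => j; rewrite fsfunE seq_fsetE mem_iota /= add0n.
case: ltnP => [jn|/h0 ->//].
by rewrite insubT /= ffunE /= inordK // ltnS.
Qed.

Definition esize a : nat := (\max_(j <- finsupp a) j.+1)%N.
Definition eheight a : nat := (\max_(j <- finsupp a) a j)%N.

Lemma esizeP a j : (esize a <= j)%N -> a j = 0%N.
Proof.
move=> h; case: finsuppP => // ja; move: h; apply: contraTeq => _.
rewrite -ltnNge; exact: (@leq_bigmax_seq _ (enum_fset (finsupp a)) xpredT succn j).
Qed.

Lemma eheightP a j : (a j <= eheight a)%N.
Proof.
case: (finsuppP a j) => // ja.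
exact: (@leq_bigmax_seq _ (enum_fset (finsupp a)) xpredT a j).
Qed.

Lemma antidiag_finite a : finite_set (antidiag a).
Proof.
pose n := esize a; pose m := eheight a.
pose D (q : {ffun 'I_n -> 'I_m.+1} * {ffun 'I_n -> 'I_m.+1}) := (edec q.1, edec q.2).
apply: (@sub_finite_set _ _ (D @` setT)); last exact/finite_image/finite_finset.
move=> [b c] /= h; exists (eenc n m b, eenc n m c) => //=.
rewrite /D /= !eencK // => j.
- by move=> /esizeP aj; have := h j; rewrite aj /=; lia.
- by have := h j; have := eheightP a j; rewrite /m /=; lia.
- by move=> /esizeP aj; have := h j; rewrite aj /=; lia.
- by have := h j; have := eheightP a j; rewrite /m /=; lia.
Qed.

Definition adseq a : seq (ell * ell) := enum_fset (fset_set (antidiag a)).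

Lemma adseq_uniq a : uniq (adseq a). Proof. exact: fset_uniq. Qed.

Lemma mem_adseq a p : (p \in adseq a) = (a == eadd p.1 p.2).
Proof.
rewrite /adseq in_fset_set; last exact: antidiag_finite.
by apply/idP/eqP; rewrite inE antidiagP.
Qed.

End Indices.

Section Weights.
Variable R : realType.
Implicit Types a b : ell.

Lemma wt_ord c a n : (forall j, (n <= j)%N -> a j = 0%N) ->
  wt c a = \prod_(j < n) ((j : nat).+1.*2%:R : R) ^ (c * (a j)%:Z).
Proof.
move=> h; pose F (j : nat) := (j.+1.*2%:R : R) ^ (c * (a j)%:Z).
rewrite /wt -(big_mkord xpredT F) /index_iota subn0.
rewrite [RHS](bigID (mem (finsupp a))) /= [X in _ * X]big1 ?mulr1; last first.
  by move=> j ja; rewrite /F fsfun_dflt // mulr0 expr0z.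
rewrite -[RHS]big_filter; apply: perm_big; apply: uniq_perm.
- exact: fset_uniq.
- by rewrite filter_uniq // iota_uniq.
move=> j; rewrite mem_filter mem_iota /= add0n.
case: (boolP (j \in finsupp a)) => //= ja; apply/esym.
rewrite ltnNge; apply/negP => /h aj0.
by move: ja; rewrite mem_finsupp aj0.
Qed.

Lemma two_neq0 (j : nat) : (j.+1.*2%:R : R) != 0.
Proof. by rewrite pnatr_eq0. Qed.

Lemma wtD c d a : wt (c + d) a = wt c a * wt d a :> R.
Proof.
rewrite /wt -big_split; apply: eq_bigr => j _.
by rewrite mulrDl expfzDr // two_neq0.
Qed.

Lemma wt0 a : wt 0 a = 1 :> R.
Proof. by rewrite /wt big1 // => j _; rewrite mul0r expr0z. Qed.

Lemma wt_gt0 c a : 0 < wt c a :> R.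
Proof.
rewrite /wt; elim/big_ind: _ => //= [x y|j _]; first exact: mulr_gt0.
by rewrite exprz_gt0 // ltr0n.
Qed.

Lemma wtNK c a : wt (- c) a * wt c a = 1 :> R.
Proof. by rewrite -wtD addNr wt0. Qed.

Lemma wt_ge1 (k : nat) a : 1 <= wt k a :> R.
Proof.
rewrite /wt; elim/big_ind: _ => //= [x y hx hy|j _].
  by rewrite -[1]mulr1 ler_pM.
by rewrite -PoszM /= exprn_ege1 // ler1n.
Qed.

Lemma wt_mono (k l : nat) a : (k <= l)%N -> wt k a <= wt l a :> R.
Proof.
move=> kl; have -> : l%:Z = k%:Z + (l - k)%N%:Z by lia.
by rewrite wtD ler_peMr ?wt_ge1 // ltW ?wt_gt0.
Qed.

Lemma wt_eadd c a b : wt c (eadd a b) = wt c a * wt c b :> R.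
Proof.
pose n := maxn (esize a) (esize b).
have ha j : (n <= j)%N -> a j = 0%N by rewrite geq_max => /andP[/esizeP].
have hb j : (n <= j)%N -> b j = 0%N by rewrite geq_max => /andP[_ /esizeP].
rewrite !(@wt_ord _ _ n) // => [|j nj]; last by rewrite eaddE ha ?hb.
rewrite -big_split; apply: eq_bigr => j _.
by rewrite eaddE PoszD mulrDr expfzDr // two_neq0.
Qed.

Lemma geom_le (x : R) m : 0 <= x -> x < 1 -> \sum_(i < m) x ^+ i <= (1 - x)^-1.
Proof.
move=> x0 x1; have x1' : 0 < 1 - x by rewrite subr_gt0.
rewrite -[leRHS]mul1r ler_pdivlMr // mulrC.
by rewrite -[1 - x]opprB mulNr -subrX1 opprB gerBl exprn_ge0.
Qed.

Lemma prod_le2 n :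
  \prod_(j < n) (1 - ((j : nat).+1.*2%:R : R) ^- 2)^-1 <= 2.
Proof.
suff h : 2^-1 + (2 * n.+1%:R)^-1 <= \prod_(j < n) (1 - ((j : nat).+1.*2%:R : R) ^- 2).
  rewrite prodfV -[leRHS]invrK lef_pV2 ?posrE ?invr_gt0 //.
    by apply: le_trans h; rewrite lerDl invr_ge0.
  by apply: lt_le_trans h; rewrite ltr_wpDr ?invr_ge0.
elim: n => [|n IH]; first by rewrite big_ord0 mulr1; lra.
rewrite big_ord_recr /=.
have n0 : (0 : R) <= n%:R by [].
have e : (n.+1.*2%:R : R) = 2 * (n%:R + 1) by rewrite -mul2n natrM natr1.
rewrite e.
have t1 : 1 <= 2 * (n%:R + 1) :> R by lra.
have t0 : 0 < 2 * (n%:R + 1) :> R by apply: lt_le_trans t1.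
have p1 : 0 <= 1 - (2 * (n%:R + 1)) ^- 2 :> R.
  by rewrite subr_ge0 invf_le1 ?exprn_gt0 // exprn_ege1.
apply: le_trans (ler_wpM2r p1 IH).
have -> : n.+2%:R = n%:R + 1 + 1 :> R by rewrite !natr1.
have -> : n.+1%:R = n%:R + 1 :> R by rewrite natr1.
rewrite -subr_ge0; set x : R := n%:R.
have -> : (2^-1 + (2 * (x + 1))^-1) * (1 - (2 * (x + 1)) ^- 2)
   - (2^-1 + (2 * (x + 1 + 1))^-1)
   = (3 * x ^+ 2 + 4 * x) / (8 * (x + 1) ^+ 3 * (x + 1 + 1)).
  by field; rewrite /x; apply/andP; split; apply/eqP; lra.
by rewrite divr_ge0 ?addr_ge0 ?mulr_ge0 ?exprn_ge0 ?addr_ge0.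
Qed.

Lemma sum_wt (s : seq ell) : uniq s -> \sum_(a <- s) wt (- 2) a <= 2 :> R.
Proof.
move=> us.
pose n := (\max_(a <- s) esize a)%N; pose m := (\max_(a <- s) eheight a)%N.
have sn a j : a \in s -> (n <= j)%N -> a j = 0%N.
  move=> sa nj; apply: esizeP; apply: leq_trans nj.
  exact: (@leq_bigmax_seq _ s xpredT esize a).
have sm a j : a \in s -> (a j <= m)%N.
  move=> sa; apply: leq_trans (eheightP a j) _.
  exact: (@leq_bigmax_seq _ s xpredT eheight a).
pose x (j : nat) : R := (j.+1.*2%:R) ^- 2.
have x0 j : 0 <= x j by rewrite /x invr_ge0 exprn_ge0.
have x1 j : x j < 1.
  rewrite /x invf_lt1 ?exprn_gt0 ?ltr0n // -natrX ltr1n.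
  by rewrite -mul2n; nia.
pose W (g : {ffun 'I_n -> 'I_m.+1}) := \prod_(j < n) x j ^+ (g j).
apply: (@le_trans _ _ (\sum_(g : {ffun 'I_n -> 'I_m.+1}) W g)).
  have -> : \sum_(a <- s) wt (- 2) a = \sum_(g <- [seq eenc n m a | a <- s]) W g.
    rewrite big_map; apply: eq_big_seq => a sa.
    rewrite (@wt_ord _ _ n); last by move=> j; apply: sn.
    apply: eq_bigr => j _; rewrite ffunE inordK ?ltnS ?sm //.
    by rewrite /x -exprVn -exprM mulNr -PoszM -exprnN exprVn.
  have ug : uniq [seq eenc n m a | a <- s].
    rewrite map_inj_in_uniq // => a b sa sb /(congr1 (@edec n m)).
    by rewrite !eencK // => j; [apply: sn|apply: sm|apply: sn|apply: sm].
  rewrite big_uniq // [leRHS](bigID (mem [seq eenc n m a | a <- s])) /= lerDl.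
  by apply: sumr_ge0 => g _; apply: prodr_ge0 => j _; apply: exprn_ge0.
rewrite /W -(bigA_distr_bigA (fun (j : 'I_n) (i : 'I_m.+1) => x j ^+ i)).
apply: le_trans (prod_le2 n); apply: ler_prod => j _.
by rewrite sumr_ge0 /= => [|i _]; rewrite ?exprn_ge0 // geom_le.
Qed.

End Weights.

Section Closure.
Variable R : realType.
Implicit Types f g : ell -> R[i].

Lemma normc_ge0 (z : R[i]) : 0 <= normc z.
Proof. by case: z => x y; rewrite sqrtr_ge0. Qed.

Lemma normcN1 (z : R[i]) : normc (- z) = normc z.
Proof. by case: z => x y; rewrite /normc /= !sqrrN. Qed.

Lemma le_normc_sum (I : Type) (s : seq I) (F : I -> R[i]) :
  normc (\sum_(i <- s) F i) <= \sum_(i <- s) normc (F i).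
Proof.
elim: s => [|i s IH]; first by rewrite !big_nil normc0.
by rewrite !big_cons; apply: le_trans (le_normcD _ _) _; rewrite lerD2l.
Qed.

Lemma kondratiev_bounded f : kondratiev f <->
  exists k : nat, exists2 M : R, 0 <= M & forall a, normc (f a) <= M * wt k a.
Proof.
split=> [[k _]|[k [M M0 hM]]].
- set S := esum _ _ => Sfin.
  have S0 : (0 <= S)%E.
    apply: esum_ge0 => a _; rewrite lee_fin mulr_ge0 ?exprn_ge0 ?normc_ge0 //.
    by rewrite ltW ?wt_gt0.
  have Sf : S \is a fin_num by rewrite ge0_fin_numE.
  have Sge a : normc (f a) ^+ 2 * wt (- k%:Z) a <= fine S.
    rewrite -lee_fin fineK //; apply: esum_ge.
    exists [set a]; first by split => //; exact: finite_set1.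
    by rewrite fsbig_set1.
  have fS0 : 0 <= fine S by rewrite fine_ge0.
  exists k, (fine S + 1); first by rewrite addr_ge0.
  move=> a; have w1 := wt_ge1 R k a; have w0 := wt_gt0 R k a.
  rewrite -(@ler_pXn2r _ 2) ?nnegrE ?normc_ge0 ?mulr_ge0 ?addr_ge0 ?(ltW w0) //.
  have := ler_wpM2r (ltW w0) (Sge a); rewrite -mulrA wtNK mulr1 => h.
  apply: le_trans h _; rewrite exprMn ler_pM ?(ltW w0) //; last by rewrite ler_eXnr.
  nra.
- exists (k + k + 2)%N; first lia.
  apply: (@le_lt_trans _ _ (M ^+ 2 * 2)%:E); last by rewrite ltry.
  apply: ub_ereal_sup => _ [A [fA _] <-].
  rewrite fsbig_finite //= sumEFin lee_fin.
  apply: le_trans (ler_wpM2l (exprn_ge0 2 M0) (sum_wt R (fset_uniq (fset_set A)))).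
  rewrite mulr_sumr; apply: ler_sum => a _.
  have -> : - (k + k + 2)%N%:Z = - k%:Z + (- k%:Z + - 2) by lia.
  rewrite wtD wtD !mulrA ler_wpM2r ?(ltW (wt_gt0 _ _ _)) //.
  have h : normc (f a) * wt (- k%:Z) a <= M.
    have := ler_wpM2r (ltW (wt_gt0 R (- k%:Z) a)) (hM a).
    by rewrite -mulrA [wt k a * _]mulrC wtNK mulr1.
  have -> : normc (f a) ^+ 2 * wt (- k%:Z) a * wt (- k%:Z) a
          = (normc (f a) * wt (- k%:Z) a) ^+ 2 by ring.
  by rewrite ler_pXn2r ?nnegrE // mulr_ge0 ?normc_ge0 // ltW ?wt_gt0.
Qed.

Lemma psmulE f g a : psmul f g a = \sum_(p <- adseq a) f p.1 * g p.2.
Proof. by rewrite /psmul fsbig_finite //; exact: antidiag_finite. Qed.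

Lemma kondratiev_const (z : R[i]) : kondratiev (psconst z).
Proof.
apply/kondratiev_bounded; exists 0%N, (normc z); first exact: normc_ge0.
move=> a; rewrite wt0 mulr1 /psconst; case: ifP => // _.
by rewrite normc0 normc_ge0.
Qed.

Lemma kondratievN f : kondratiev f -> kondratiev (fun a => - f a).
Proof.
move=> /kondratiev_bounded[k [M M0 h]]; apply/kondratiev_bounded.
by exists k, M => // a; rewrite normcN1.
Qed.

Lemma kondratievD f g :
  kondratiev f -> kondratiev g -> kondratiev (fun a => f a + g a).
Proof.
move=> /kondratiev_bounded[k [M M0 hf]] /kondratiev_bounded[l [M' M0' hg]].
apply/kondratiev_bounded; exists (maxn k l), (M + M'); first exact: addr_ge0.
move=> a; apply: le_trans (le_normcD _ _) _; rewrite mulrDl lerD //.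
  by apply: le_trans (hf a) _; rewrite ler_wpM2l // wt_mono // leq_maxl.
by apply: le_trans (hg a) _; rewrite ler_wpM2l // wt_mono // leq_maxr.
Qed.

Lemma adseq_card a : \sum_(p <- adseq a) 1 <= 2 * wt 2 a :> R.
Proof.
have w0 := wt_gt0 R 2 a.
rewrite mulrC -ler_pdivrMl // mulr_sumr.
have u1 : uniq [seq p.1 | p <- adseq a].
  rewrite map_inj_in_uniq ?adseq_uniq // => -[b c] [b' c'].
  rewrite !mem_adseq /= => /eqP h /eqP h' e; move: h'; rewrite -e => h'.
  by congr pair; apply: ell_ext => j; move/fsfunP/(_ j): h;
     move/fsfunP/(_ j): h'; rewrite !eaddE; lia.
apply: le_trans (sum_wt R u1); rewrite big_map.
rewrite big_seq_cond [leRHS]big_seq_cond; apply: ler_sum => -[b c].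
rewrite mem_adseq andbT /= => /eqP ->.
rewrite mulr1 wt_eadd invfM -[leRHS]mulr1.
have e (d : ell) : (wt 2 d)^-1 = wt (- 2) d :> R.
  by apply: (mulIf (lt0r_neq0 (wt_gt0 R 2 d))); rewrite wtNK mulVf // lt0r_neq0 ?wt_gt0.
rewrite e ler_wpM2l ?(ltW (wt_gt0 _ _ _)) // invf_le1 ?wt_gt0 //.
exact: (wt_ge1 R 2).
Qed.

Lemma kondratievM f g : kondratiev f -> kondratiev g -> kondratiev (psmul f g).
Proof.
move=> /kondratiev_bounded[k [M M0 hf]] /kondratiev_bounded[l [M' M0' hg]].
apply/kondratiev_bounded; exists (maxn k l + 2)%N, (M * M' * 2).
  by rewrite !mulr_ge0.
move=> a; rewrite psmulE; apply: le_trans (le_normc_sum _ _) _.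
rewrite PoszD wtD; set m := maxn k l; have h0 : 0 <= M * M' * wt m a :> R.
  by rewrite !mulr_ge0 // ltW ?wt_gt0.
have -> : M * M' * 2 * (wt m a * wt 2 a) = M * M' * wt m a * (2 * wt 2 a) :> R by ring.
apply: le_trans (ler_wpM2l h0 (adseq_card a)); rewrite mulr_sumr.
rewrite big_seq_cond [leRHS]big_seq_cond; apply: ler_sum => -[b c].
rewrite mem_adseq andbT /= => /eqP ->.
rewrite mulr1 normcM wt_eadd.
have -> : M * M' * (wt m b * wt m c) = (M * wt m b) * (M' * wt m c) :> R by ring.
rewrite ler_pM ?normc_ge0 //.
  by apply: le_trans (hf b) _; rewrite ler_wpM2l // wt_mono // leq_maxl.
by apply: le_trans (hg c) _; rewrite ler_wpM2l // wt_mono // leq_maxr.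
Qed.

End Closure.

(* The ring of Hermite transforms of elements of S_{-1}. *)
Record frakR (R : realType) := FrakR {
  coef :> ell -> R[i];
  coefP : kondratiev coef }.

HB.instance Definition _ (R : realType) := gen_eqMixin (frakR R).
HB.instance Definition _ (R : realType) := gen_choiceMixin (frakR R).

Definition cst {R : realType} (z : R[i]) : frakR R := FrakR (kondratiev_const z).

Section Ring.
Variable R : realType.
Implicit Types f g h : frakR R.

Lemma frakR_ext f g : (forall a, f a = g a) -> f = g.
Proof.
case: f g => [f fP] [g gP] /= /funext fg; subst g.
by congr FrakR; apply: Prop_irrelevance.
Qed.

Definition fradd f g : frakR R := FrakR (kondratievD (coefP f) (coefP g)).
Definition fropp f : frakR R := FrakR (kondratievN (coefP f)).
Definition frmul f g : frakR R := FrakR (kondratievM (coefP f) (coefP g)).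

Lemma fraddA : associative fradd.
Proof. by move=> f g h; apply: frakR_ext => a; apply: addrA. Qed.
Lemma fraddC : commutative fradd.
Proof. by move=> f g; apply: frakR_ext => a; apply: addrC. Qed.
Lemma fradd0 : left_id (cst 0) fradd.
Proof.
by move=> f; apply: frakR_ext => a; rewrite /= /psconst; case: ifP; rewrite add0r.
Qed.
Lemma fraddN : left_inverse (cst 0) fropp fradd.
Proof.
by move=> f; apply: frakR_ext => a; rewrite /= /psconst; case: ifP; rewrite addNr.
Qed.

HB.instance Definition _ :=
  GRing.isZmodule.Build (frakR R) fraddA fraddC fradd0 fraddN.

Lemma frmulC : commutative frmul.
Proof.
move=> f g; apply: frakR_ext => a /=; rewrite !psmulE.
rewrite [RHS](perm_big [seq (p.2, p.1) | p <- adseq a]) /=.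
  by rewrite big_map; apply: eq_bigr => p _; rewrite mulrC.
apply: uniq_perm; first exact: adseq_uniq.
  by rewrite map_inj_uniq ?adseq_uniq // => -[? ?] [? ?] [-> ->].
have eC b c : eadd b c = eadd c b by apply: ell_ext => j; rewrite !eaddE addnC.
move=> [b c]; apply/idP/mapP => [|[[b' c'] + [-> ->]]].
  by rewrite mem_adseq => /eqP->; exists (c, b); rewrite // mem_adseq /= eC eqxx.
by rewrite !mem_adseq => /eqP->; rewrite /= eC eqxx.
Qed.

Lemma eaddA (a b c : ell) : eadd a (eadd b c) = eadd (eadd a b) c.
Proof. by apply: ell_ext => j; rewrite !eaddE addnA. Qed.

Lemma frmulA : associative frmul.
Proof.
move=> f g h; apply: frakR_ext => a /=; rewrite !psmulE.
pose T := (ell * ell * ell)%type.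
pose G (t : T) := f t.1.1 * g t.1.2 * h t.2.
pose s1 : seq T := [seq (p.1, q.1, q.2) | p <- adseq a, q <- adseq p.2].
pose s2 : seq T := [seq (q.1, q.2, p.2) | p <- adseq a, q <- adseq p.1].
transitivity (\sum_(t <- s1) G t).
  rewrite /s1 big_allpairs_dep; apply: eq_bigr => p _ /=.
  by rewrite psmulE mulr_sumr; apply: eq_bigr => q _; rewrite mulrA.
transitivity (\sum_(t <- s2) G t); last first.
  rewrite /s2 big_allpairs_dep; apply: eq_bigr => p _ /=.
  by rewrite psmulE mulr_suml; apply: eq_bigr.
apply: perm_big; apply: uniq_perm.
- apply: allpairs_uniq_dep => [|p _|]; try exact: adseq_uniq.
  move=> x y /allpairsPdep[p [q [pa qp ->]]] /allpairsPdep[p' [q' [pa' qp' ->]]] /=.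
  move: pa qp pa' qp'; rewrite !mem_adseq.
  case: p p' q q' => [b c] [b' c'] [d e] [d' e'] /= _ /eqP-> _ /eqP->.
  by case=> -> -> ->.
- apply: allpairs_uniq_dep => [|p _|]; try exact: adseq_uniq.
  move=> x y /allpairsPdep[p [q [pa qp ->]]] /allpairsPdep[p' [q' [pa' qp' ->]]] /=.
  move: pa qp pa' qp'; rewrite !mem_adseq.
  case: p p' q q' => [b c] [b' c'] [d e] [d' e'] /= _ /eqP-> _ /eqP->.
  by case=> -> -> ->.
move=> [[b c] d]; apply/allpairsPdep/allpairsPdep => /=.
  move=> [[p1 p2] [[q1 q2] []]]; rewrite !mem_adseq /= => /eqP-> /eqP-> [-> -> ->].
  by exists (eadd p1 q1, q2), (p1, q1); rewrite !mem_adseq /= eaddA !eqxx.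
move=> [[p1 p2] [[q1 q2] []]]; rewrite !mem_adseq /= => /eqP-> /eqP-> [-> -> ->].
by exists (q1, eadd q2 p2), (q2, p2); rewrite !mem_adseq /= eaddA !eqxx.
Qed.

Lemma frmul1 : left_id (cst 1) frmul.
Proof.
move=> f; apply: frakR_ext => a; rewrite /= psmulE.
have e0 : eadd [fsfun] a = a by apply: ell_ext => j; rewrite eaddE ell0E.
have ha : ([fsfun], a) \in adseq a by rewrite mem_adseq /= e0.
rewrite (bigD1_seq _ ha (adseq_uniq a)) /= {1}/psconst eqxx mul1r.
rewrite big_seq_cond big1 ?addr0 // => -[b c] /andP[]; rewrite mem_adseq /= => /eqP h.
move=> /eqP neq; rewrite /psconst; case: eqP => [b0|]; last by rewrite mul0r.
case: neq; rewrite h b0; congr pair.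
by apply: ell_ext => j; rewrite eaddE ell0E.
Qed.

Lemma frmulDl : left_distributive frmul fradd.
Proof.
move=> f g h; apply: frakR_ext => a /=; rewrite !psmulE -big_split.
by apply: eq_bigr => p _; rewrite mulrDl.
Qed.

Lemma cst_inj : injective (@cst R).
Proof. by move=> x y /(congr1 (fun f : frakR R => f [fsfun])); rewrite /= /psconst eqxx. Qed.

Lemma fr1_neq0 : cst 1 != 0 :> frakR R.
Proof. by apply/eqP => /cst_inj/eqP; rewrite oner_eq0. Qed.

HB.instance Definition _ :=
  GRing.Zmodule_isComNzRing.Build (frakR R) frmulA frmulC frmul1 frmulDl fr1_neq0.

Definition frunit : {pred frakR R} := fun f => `[< exists g, g * f = 1 >].
Definition frinv f : frakR R :=
  if pselect (exists g, g * f = 1) is left h then projT1 (cid h) else f.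

Lemma frmulV : {in frunit, left_inverse 1 frinv *%R}.
Proof.
move=> f; rewrite unfold_in => /asboolP hf; rewrite /frinv.
by case: pselect => // h; case: cid.
Qed.

Lemma frunitP f g : g * f = 1 -> frunit f.
Proof. by move=> h; apply/asboolP; exists g. Qed.

Lemma frinv_out : {in [predC frunit], frinv =1 id}.
Proof.
move=> f; rewrite inE unfold_in => /asboolPn hf; rewrite /frinv.
by case: pselect.
Qed.

HB.instance Definition _ := GRing.ComNzRing_hasMulInverse.Build (frakR R)
  frmulV frunitP frinv_out.

End Ring.

Definition at0 {R : realType} (f : frakR R) : R[i] := f [fsfun].

Section Inverse.
Variable R : realType.
Implicit Types f g h : frakR R.

Lemma coefD f g a : (f + g) a = f a + g a. Proof. by []. Qed.
Lemma coefM f g a : (f * g) a = \sum_(p <- adseq a) f p.1 * g p.2.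
Proof. exact: psmulE. Qed.
Lemma coef1 a : (1 : frakR R) a = if a == [fsfun] then 1 else 0.
Proof. by []. Qed.
Lemma coef0 a : (0 : frakR R) a = 0.
Proof. by rewrite /= /psconst; case: ifP. Qed.
Lemma coef_sum (I : Type) (s : seq I) (F : I -> frakR R) a :
  (\sum_(i <- s) F i) a = \sum_(i <- s) F i a.
Proof.
elim: s => [|i s IH]; first by rewrite !big_nil coef0.
by rewrite !big_cons coefD IH.
Qed.

Lemma adseq0 : adseq [fsfun] = [:: ([fsfun], [fsfun])].
Proof.
apply: perm_small_eq => //; apply: uniq_perm => //; first exact: adseq_uniq.
move=> [b c]; rewrite mem_adseq inE /=; apply/eqP/eqP => [h|[-> ->]].
  have z j : (b j + c j)%N = 0%N by rewrite -eaddE -h ell0E.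
  by congr pair; apply: ell_ext => j; have := z j; rewrite ell0E; lia.
by apply: ell_ext => j; rewrite eaddE ell0E.
Qed.

Lemma at0_is_additive : {morph @at0 R : f g / f - g >-> f - g}.
Proof. by []. Qed.
Lemma at0_is_multiplicative : monoid_morphism (@at0 R).
Proof.
split; first by rewrite /at0 coef1 eqxx.
by move=> f g; rewrite /at0 coefM adseq0 big_seq1.
Qed.
HB.instance Definition _ :=
  GRing.isZmodMorphism.Build (frakR R) R[i] (@at0 R) at0_is_additive.
HB.instance Definition _ :=
  GRing.isMonoidMorphism.Build (frakR R) R[i] (@at0 R) at0_is_multiplicative.

Lemma at0_cst z : at0 (@cst R z) = z.
Proof. by rewrite /at0 /= /psconst eqxx. Qed.

End Inverse.

Section Units.
Variable R : realType.
Implicit Types f g h : frakR R.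

Definition edeg (a : ell) : nat := (\sum_(j <- finsupp a) a j)%N.

Lemma edeg_ord n (a : ell) : (forall j, (n <= j)%N -> a j = 0%N) ->
  edeg a = (\sum_(j < n) a j)%N.
Proof.
move=> h; rewrite /edeg -(big_mkord xpredT a) /index_iota subn0.
rewrite [RHS](bigID (mem (finsupp a))) /= [X in (_ + X)%N]big1 ?addn0; last first.
  by move=> j ja; rewrite fsfun_dflt.
rewrite -[RHS]big_filter; apply: perm_big; apply: uniq_perm.
- exact: fset_uniq.
- by rewrite filter_uniq // iota_uniq.
move=> j; rewrite mem_filter mem_iota /= add0n.
case: (boolP (j \in finsupp a)) => //= ja; apply/esym.
rewrite ltnNge; apply/negP => /h aj0.
by move: ja; rewrite mem_finsupp aj0.
Qed.

Lemma edegD b c : edeg (eadd b c) = (edeg b + edeg c)%N.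
Proof.
pose n := maxn (esize b) (esize c).
have hb j : (n <= j)%N -> b j = 0%N by rewrite geq_max => /andP[/esizeP].
have hc j : (n <= j)%N -> c j = 0%N by rewrite geq_max => /andP[_ /esizeP].
rewrite !(@edeg_ord n) // => [|j nj]; last by rewrite eaddE hb ?hc.
by rewrite -big_split; apply: eq_bigr => j _; rewrite eaddE.
Qed.

Lemma edeg_gt0 a : a != [fsfun] -> (0 < edeg a)%N.
Proof.
move=> a0; rewrite lt0n; apply: contraNneq a0 => d0; apply/eqP/ell_ext => j.
rewrite ell0E; case: (finsuppP a j) => // ja.
move/eqP: d0; rewrite /edeg sum_nat_seq_eq0 => /allP/(_ j ja)/eqP.
by [].
Qed.

Lemma wt_ge2X (t : nat) (b : ell) : b != [fsfun] -> 2 ^+ t <= wt t b :> R.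
Proof.
move=> /edeg_gt0 d0; apply: (@le_trans _ _ (2 ^+ (t * edeg b))).
  by rewrite ler_weXn2l ?ler1n // leq_pmulr.
rewrite /edeg big_distrr /= -prodrXr; apply: ler_prod => j _.
rewrite exprn_ge0 //= -PoszM lerXn2r ?nnegrE // -mul2n natrM ler_peMr //.
by rewrite ler1n.
Qed.

Lemma expr_vanish g n a : at0 g = 0 -> (edeg a < n)%N -> (g ^+ n) a = 0.
Proof.
move=> g0; elim: n a => // n IH a an; rewrite exprS coefM big_seq_cond big1 //.
move=> [b c]; rewrite mem_adseq andbT => /eqP e; rewrite /= in e *.
have [->|b0] := eqVneq b [fsfun]; first by rewrite [X in X * _]g0 mul0r.
rewrite IH ?mulr0 //; have := edeg_gt0 b0; move: an; rewrite e edegD; lia.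
Qed.

Lemma adseq_uniq1 a : uniq [seq p.1 | p <- adseq a].
Proof.
rewrite map_inj_in_uniq ?adseq_uniq // => -[b c] [b' c'].
rewrite !mem_adseq /= => /eqP h /eqP h' e; move: h'; rewrite -e => h'.
by congr pair; apply: ell_ext => j; move/fsfunP/(_ j): h;
   move/fsfunP/(_ j): h'; rewrite !eaddE; lia.
Qed.

Lemma small_weight g : at0 g = 0 -> exists K : nat, forall s : seq ell,
  uniq s -> \sum_(b <- s) normc (g b) * wt (- K%:Z) b <= 2^-1 :> R.
Proof.
move=> g0; have /kondratiev_bounded[k [M M0 hM]] := coefP g.
pose t := Num.bound (4 * M).
have ht : 4 * M <= 2 ^+ t.+1.
  apply: (@le_trans _ _ t%:R); first by apply/ltW/archi_boundP; rewrite mulr_ge0.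
  by rewrite -natrX ler_nat ltnW // (leq_trans (ltnSn t)) // ltnW // ltn_expl.
exists (k + 2 + t.+1)%N => s us.
have h b : normc (g b) * wt (- (k + 2 + t.+1)%N%:Z) b <= M / 2 ^+ t.+1 * wt (- 2) b.
  have [->|b0] := eqVneq b [fsfun].
    have -> : g [fsfun] = 0 by exact: g0.
    by rewrite normc0 mul0r !mulr_ge0 ?invr_ge0 ?exprn_ge0 // ltW ?wt_gt0.
  have -> : - (k + 2 + t.+1)%N%:Z = - k%:Z + (- 2%:Z + - t.+1%:Z) by lia.
  rewrite !wtD.
  have h1 : normc (g b) * wt (- k%:Z) b <= M.
    have := ler_wpM2r (ltW (wt_gt0 R (- k%:Z) b)) (hM b).
    by rewrite -mulrA [wt k b * _]mulrC wtNK mulr1.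
  have h2 : wt (- t.+1%:Z) b <= (2 ^+ t.+1)^-1 :> R.
    rewrite -[leRHS]mulr1 ler_pdivlMl ?exprn_gt0 //.
    rewrite -[leRHS](wtNK R t.+1 b) mulrC ler_wpM2l ?(ltW (wt_gt0 _ _ _)) //.
    exact: wt_ge2X.
  set w2 := wt (- 2%:Z) b.
  have -> : normc (g b) * (wt (- k%:Z) b * (w2 * wt (- t.+1%:Z) b)) =
    normc (g b) * wt (- k%:Z) b * wt (- t.+1%:Z) b * w2 by ring.
  rewrite ler_wpM2r ?(ltW (wt_gt0 _ _ _)) //.
  by rewrite ler_pM ?mulr_ge0 ?normc_ge0 // ltW ?wt_gt0.
apply: le_trans (ler_sum _ (fun b _ => h b)) _; rewrite -mulr_sumr.
apply: le_trans (ler_wpM2l _ (sum_wt R us)) _; first by rewrite divr_ge0 ?exprn_ge0.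
by rewrite mulrAC ler_pdivrMr ?exprn_gt0 // mulrC; lra.
Qed.

Lemma expr_bound g K n a :
  (forall s : seq ell, uniq s ->
    \sum_(b <- s) normc (g b) * wt (- K%:Z) b <= 2^-1 :> R) ->
  normc ((g ^+ n) a) <= 2 ^- n * wt K a.
Proof.
move=> hK; elim: n a => [|n IH] a.
  rewrite expr0 coef1 expr0 invr1 mul1r; case: ifP => _.
    by rewrite normc1 wt_ge1.
  by rewrite normc0 ltW ?wt_gt0.
rewrite exprS coefM; apply: le_trans (le_normc_sum _ _) _.
apply: (@le_trans _ _ (2 ^- n * wt K a *
    \sum_(p <- adseq a) normc (g p.1) * wt (- K%:Z) p.1)).
  rewrite mulr_sumr big_seq_cond [leRHS]big_seq_cond; apply: ler_sum => -[b c].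
  rewrite mem_adseq andbT /= => /eqP->; rewrite normcM wt_eadd.
  have -> : 2 ^- n * (wt K b * wt K c) * (normc (g b) * wt (- K%:Z) b)
     = normc (g b) * (2 ^- n * wt K c) * (wt (- K%:Z) b * wt K b) :> R by ring.
  by rewrite wtNK mulr1 ler_wpM2l ?normc_ge0.
have := hK _ (adseq_uniq1 a); rewrite big_map => h.
apply: le_trans (ler_wpM2l _ h) _.
  by rewrite mulr_ge0 ?invr_ge0 ?exprn_ge0 // ltW ?wt_gt0.
by rewrite exprS invfM mulrC mulrA.
Qed.

Lemma neumann g : at0 g = 0 -> (1 - g) \is a GRing.unit.
Proof.
move=> g0; have [K hK] := small_weight g0.
pose S m : frakR R := \sum_(n < m) g ^+ n.
pose u (a : ell) := S (edeg a).+1 a.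
have uS m a : (edeg a < m)%N -> S m a = u a.
  move=> am; rewrite /u /S !coef_sum.
  rewrite -!(big_mkord xpredT (fun n => (g ^+ n) a)) (big_cat_nat _ am) //=.
  rewrite [X in _ + X]big1_seq ?addr0 // => n /andP[_].
  by rewrite mem_index_iota => /andP[hn _]; apply: expr_vanish.
have ku : kondratiev u.
  apply/kondratiev_bounded; exists K, 2 => // a.
  rewrite /u /S coef_sum; apply: le_trans (le_normc_sum _ _) _.
  apply: (@le_trans _ _ (\sum_(n < (edeg a).+1) 2 ^- n * wt K a)).
    by apply: ler_sum => n _; apply: expr_bound.
  rewrite -mulr_suml ler_wpM2r ?(ltW (wt_gt0 _ _ _)) //.
  have := @geom_le R 2^-1 (edeg a).+1.
  under eq_bigr do rewrite exprVn.
  have -> : (1 - 2^-1)^-1 = 2 :> R by rewrite [X in X - _](splitr 1) mul1r addrK invrK.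
  by apply; lra.
suff h : FrakR ku * (1 - g) = 1 by exact: (frunitP h).
apply: frakR_ext => a; rewrite coefM.
transitivity ((S (edeg a).+1 * (1 - g)) a).
  rewrite coefM big_seq_cond [RHS]big_seq_cond; apply: eq_bigr => -[b c].
  rewrite mem_adseq andbT /= => /eqP e; rewrite uS // e edegD; lia.
have -> : S (edeg a).+1 * (1 - g) = 1 - g ^+ (edeg a).+1.
  by rewrite -opprB mulrN mulrC -subrX1 opprB.
by rewrite coefD [X in _ + X](_ : _ = - (g ^+ (edeg a).+1) a) // expr_vanish // oppr0 addr0.
Qed.

Lemma cstM (x y : R[i]) : cst (x * y) = cst x * cst y.
Proof.
apply: frakR_ext => a; rewrite coefM /= /psconst.
case: eqP => [->|a0]; first by rewrite adseq0 big_seq1 /= eqxx.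
rewrite big_seq_cond big1 // => -[b c]; rewrite mem_adseq andbT /= => /eqP e.
case: (b =P [fsfun]) => [b0|]; last by rewrite mul0r.
case: (c =P [fsfun]) => [c0|]; last by rewrite mulr0.
by case: a0; rewrite e b0 c0; apply: ell_ext => j; rewrite eaddE ell0E.
Qed.

(* A series is invertible as soon as its constant coefficient is non-zero. *)
Lemma unit_at0 f : (f \is a GRing.unit) = (at0 f != 0).
Proof.
apply/idP/idP => [fu|f0]; first by rewrite -unitfE rmorph_unit.
have cu x : x != 0 -> @cst R x \is a GRing.unit.
  by move=> x0; apply/unitrPr; exists (cst x^-1); rewrite -cstM mulfV.
have <- : (f * cst (at0 f)^-1 \is a GRing.unit) = (f \is a GRing.unit).
  by rewrite unitrM cu ?invr_neq0 // andbT.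
rewrite -[X in X \is a _](subKr 1); apply: neumann.
have -> : at0 (1 - f * cst (at0 f)^-1) = 1 - at0 f * at0 (cst (at0 f)^-1).
  by rewrite rmorphB rmorphM rmorph1.
by rewrite at0_cst mulfV // subrr.
Qed.

Lemma resolvent_unit N (A : 'M[frakR R]_N) z :
  \det (1%:M - z *: map_mx at0 A) != 0 ->
  1%:M - cst z *: A \in unitmx.
Proof.
move=> h; rewrite unitmxE unit_at0 -det_map_mx map_mxB map_mx1 map_mxZ.
by rewrite [X in X *: _](at0_cst z).
Qed.

End Units.

(* A realization D + z C (1 - z A)^-1 B, given by its four coefficients:
   controllability and observability are properties of the coefficients. *)
Record realization (T : Type) (N p q : nat) := Realization {
  rA : 'M[T]_N;
  rB : 'M[T]_(N, q);
  rC : 'M[T]_(p, N);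
  rD : 'M[T]_(p, q) }.

Definition realization_at0 {R : realType} {N p q : nat}
    (H : realization (frakR R) N p q) : realization R[i] N p q :=
  Realization (map_mx at0 (rA H)) (map_mx at0 (rB H))
              (map_mx at0 (rC H)) (map_mx at0 (rD H)).

Definition controllability_mx {T : pzRingType} {N p q : nat}
    (H : realization T N p q) : 'M[T]_(N, \sum_(k < N) q) :=
  \mxrow_(k < N) (rA H ^+ k *m rB H).

Definition controllable {K : fieldType} {N p q : nat}
    (H : realization K N p q) : Prop :=
  (<<[seq col j (controllability_mx H) | j : 'I_(\sum_(k < N) q)]>> = fullv)%VS.

Definition observable {T : pzRingType} {N p q : nat}
    (H : realization T N p q) : Prop :=
  injective (fun (f : 'cV[T]_N) (k : nat) => rC H *m rA H ^+ k *m f).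

Definition minimal {K : fieldType} {N p q : nat}
    (H : realization K N p q) : Prop :=
  controllable H /\ observable H.

(* By [resolvent_unit], [invmx] is only applied to invertible matrices here. *)
Definition frakR_controllable {R : realType} {N p q : nat}
    (H : realization (frakR R) N p q) : Prop :=
  forall f : 'rV[frakR R]_N,
    (forall z : R[i], \det (1%:M - z *: map_mx at0 (rA H)) != 0 ->
       f *m invmx (1%:M - cst z *: rA H) *m rB H = 0) ->
    f = 0.

Definition frakR_minimal {R : realType} {N p q : nat}
    (H : realization (frakR R) N p q) : Prop :=
  observable H /\ frakR_controllable H.

(* Main.v *)
Require Import Defs.
From mathcomp Require Import all_boot all_order all_algebra finmap.
From mathcomp Require Import boolp classical_sets reals complex.

(** Why the theorem holds.  A nonzero vector [f] over the ring of series has a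
    nonzero coefficient vector [f_a] of least total degree [edeg a].  In a
    product [f *m M] every term of degree [edeg a] other than [f_a *m M(0)]
    involves a coefficient of [f] of lower degree, so the coefficient of index
    [a] of [f *m M] is [f_a *m M(0)] ([coefmx_mulr]; [coefmx_mull] on the other
    side).  A linear identity satisfied by [f] over the ring therefore passes,
    with the coefficients of the identity replaced by their constant terms, to
    the complex vector [f_a], and a realization whose value at 0 is observable
    or controllable forces [f_a = 0].  The principle [coefmx_eq0] turns this
    into [f = 0].

    For observability the identities are [C A^k f = 0] for all [k], and nothing
    more is needed.  For controllability the hypothesis becomes
    [f_a (I - z A(0))^-1 B(0) = 0] for all [z] at which the inverse exists, and
    one has to extract [f_a A(0)^k B(0) = 0] for all [k]
    ([resolvent_vanish_markov]).  By Cramer's rule the left-hand side is a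
    polynomial in [z] divided by [det (I - z A(0))], so it vanishes at [z = 0]
    as soon as it vanishes off the roots of a nonzero polynomial; this gives
    [f_a B(0) = 0], and [z v A (I - z A)^-1 = v (I - z A)^-1 - v] passes from
    [v] to [v A]. *)

Set Implicit Arguments.
Unset Strict Implicit.
Unset Printing Implicit Defensive.

Import GRing.Theory.

Local Open Scope ring_scope.

Lemma map_horner_polyC (K : comNzRingType) (m n : nat) (F : 'M[K]_(m, n)) (z : K) :
  map_mx (horner_eval z) (map_mx polyC F) = F.
Proof. by apply/matrixP => i j; rewrite !mxE /= /horner_eval hornerC. Qed.

Lemma resolvent_poly_eval (K : comUnitRingType) (N : nat) (A : 'M[K]_N) (z : K) :
  map_mx (horner_eval z) (1%:M - 'X *: map_mx polyC A) = 1%:M - z *: A.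
Proof.
by rewrite map_mxB map_mx1 map_mxZ [X in X *: _]hornerX map_horner_polyC.
Qed.

Lemma adj_unitmx (K : comUnitRingType) (N : nat) (M : 'M[K]_N) :
  M \in unitmx -> \adj M = \det M *: invmx M.
Proof.
move=> Mu; by rewrite /invmx Mu scalerA divrr ?scale1r.
Qed.

(** The adjugate clears the denominator: [v *m \adj (I - z A) *m B] is a vector
    of polynomials in [z], zero because it vanishes off the roots of
    [r * det (I - z A)], and its value at [z = 0] is [v *m B].  The factor [r]
    allows finitely many values of [z], 0 among them, to be excluded. *)
Lemma resolvent_vanish_at0 (K : closedFieldType) (N q : nat) (A : 'M[K]_N)
    (B : 'M[K]_(N, q)) (v : 'rV[K]_N) (r : {poly K}) : r != 0 ->
  (forall z, r.[z] != 0 -> \det (1%:M - z *: A) != 0 ->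
     v *m invmx (1%:M - z *: A) *m B = 0) ->
  v *m B = 0.
Proof.
move=> r0 hv.
pose M : 'M[{poly K}]_N := 1%:M - 'X *: map_mx polyC A.
pose S := map_mx polyC v *m \adj M *m map_mx polyC B.
have Sz z : map_mx (horner_eval z) S = v *m \adj (1%:M - z *: A) *m B.
  by rewrite !map_mxM map_mx_adj resolvent_poly_eval !map_horner_polyC.
have dz z : (\det M).[z] = \det (1%:M - z *: A).
  by rewrite -resolvent_poly_eval det_map_mx.
have d0 : \det M != 0.
  apply/eqP => d0; have := dz 0; rewrite d0 horner0 scale0r subr0 det1.
  by move/esym/eqP; rewrite oner_eq0.
have S0 : S = 0.
  apply/matrixP => i j; rewrite [RHS]mxE.
  apply/eqP; apply: contraT => Sij.
  have /closed_nonrootP[z] : r * \det M * S i j != 0 by rewrite !mulf_neq0.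
  rewrite /root !hornerM !mulf_eq0 !negb_or dz => /andP[/andP[rz dz0]].
  have -> : (S i j).[z] = map_mx (horner_eval z) S i j by rewrite [RHS]mxE.
  rewrite Sz adj_unitmx ?unitmxE ?unitfE // -scalemxAr -scalemxAl hv //.
  by rewrite scaler0 mxE eqxx.
by have := Sz 0; rewrite S0 map_mx0 scale0r subr0 adj1 mulmx1.
Qed.

(** The step from [v] to [v *m A] divides by [z], hence loses [z = 0]; replacing
    the excluded set, the roots of [r], by those of ['X * r] pays for it. *)
Lemma resolvent_vanish_markov (K : closedFieldType) (N q : nat) (A : 'M[K]_N)
    (B : 'M[K]_(N, q)) (k : nat) (v : 'rV[K]_N) (r : {poly K}) : r != 0 ->
  (forall z, r.[z] != 0 -> \det (1%:M - z *: A) != 0 ->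
     v *m invmx (1%:M - z *: A) *m B = 0) ->
  v *m (A ^+ k *m B) = 0.
Proof.
elim: k v r => [|k IH] v r r0 hv.
  by rewrite expr0 mul1mx; apply: (resolvent_vanish_at0 r0 hv).
have vB := resolvent_vanish_at0 r0 hv.
rewrite exprS -mulmxA mulmxA; apply: (IH _ ('X * r)).
  by rewrite mulf_neq0 // polyX_eq0.
move=> z; rewrite hornerM hornerX mulf_eq0 negb_or => /andP[z0 rz] dz.
have Mu : 1%:M - z *: A \in unitmx by rewrite unitmxE unitfE.
(* Here z A is written I - (I - z A), so that one factor cancels the inverse. *)
apply: (scalerI z0); rewrite scaler0 -!mulmxA scalemxAr scalemxAl.
rewrite -{1}[z *: A](subKr 1%:M) mulmxBl mul1mx mulKVmx //.
rewrite mulmxBr vB subr0 mulmxA.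
exact: hv.
Qed.

(** The columns of the controllability matrix span the space, so the linear form
    [mulmx v] is zero once it vanishes on them. *)
Lemma controllable_mulmx_eq0 (K : fieldType) (N p q : nat)
    (H : realization K N p q) (v : 'rV[K]_N) : controllable H ->
  (forall k, v *m (rA H ^+ k *m rB H) = 0) -> v = 0.
Proof.
move=> /fullv_lfunP spanH hv.
have v0 : linfun (mulmx v) = 0 :> 'Hom('cV[K]_N, 'cV[K]_1).
  apply/spanH => _ /mapP[j _ ->]; rewrite lfunE zero_lfunE /=.
  rewrite colE mulmxA mul_mxrow.
  by under eq_mxrow do rewrite hv; rewrite mxrow0 mul0mx.
apply/rowP => i; have := congr1 (fun f : 'Hom('cV[K]_N, 'cV[K]_1) => f (delta_mx i 0)) v0.
by rewrite /= lfunE zero_lfunE /= -colE => /colP/(_ 0); rewrite !mxE.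
Qed.

Section LowestTerm.
Variable R : realType.
Implicit Types (f g : frakR R) (a b : ell).

(** If [a = b + c] with [c] nonzero then [b] has lower total degree than [a];
    only the splitting [(a, 0)] survives in the Cauchy product. *)
Lemma coefM_lowest f g a : (forall b, (edeg b < edeg a)%N -> f b = 0) ->
  (f * g) a = f a * at0 g.
Proof.
move=> fa; have e0 b : eadd b [fsfun] = b.
  by apply: ell_ext => j; rewrite eaddE ell0E addn0.
have ha : (a, [fsfun]) \in adseq a by rewrite mem_adseq /= e0.
rewrite Defs.coefM (bigD1_seq _ ha (adseq_uniq a)) /= big_seq_cond big1 ?addr0 //.
move=> [b c] /andP[]; rewrite mem_adseq /= => /eqP ebc nbc.
have c0 : c != [fsfun] by apply: contraNneq nbc => c0; rewrite ebc c0 e0.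
by rewrite fa ?mul0r // ebc edegD -[X in (X < _)%N]addn0 ltn_add2l edeg_gt0.
Qed.

Definition coefmx m n a (F : 'M[frakR R]_(m, n)) : 'M[R[i]]_(m, n) :=
  map_mx (fun f : frakR R => f a) F.

Lemma coefmx_mulr m n s a (F : 'M[frakR R]_(m, n)) (G : 'M[frakR R]_(n, s)) :
  (forall b, (edeg b < edeg a)%N -> coefmx b F = 0) ->
  coefmx a (F *m G) = coefmx a F *m map_mx at0 G.
Proof.
move=> Fa; apply/matrixP => i j; rewrite !mxE Defs.coef_sum.
apply: eq_bigr => k _; rewrite !mxE coefM_lowest // => b ba.
by have /matrixP/(_ i k) := Fa b ba; rewrite !mxE.
Qed.

Lemma coefmx_mull m n s a (G : 'M[frakR R]_(m, n)) (F : 'M[frakR R]_(n, s)) :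
  (forall b, (edeg b < edeg a)%N -> coefmx b F = 0) ->
  coefmx a (G *m F) = map_mx at0 G *m coefmx a F.
Proof.
move=> Fa; apply: (can_inj (@trmxK _ _ _)).
rewrite trmx_mul [LHS]map_trmx trmx_mul -/(coefmx a _) coefmx_mulr.
  by rewrite /coefmx -!map_trmx.
move=> b ba.
by rewrite /coefmx -map_trmx [map_mx _ F](Fa b ba) trmx0.
Qed.

(** The form in which the lowest-degree coefficient is used: induction on the
    total degree instead of the choice of a minimal index. *)
Lemma coefmx_eq0 m n (F : 'M[frakR R]_(m, n)) :
  (forall a, (forall b, (edeg b < edeg a)%N -> coefmx b F = 0) ->
     coefmx a F = 0) ->
  F = 0.
Proof.
move=> Fa; have F0 d : forall a, (edeg a < d)%N -> coefmx a F = 0.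
  elim: d => // d IH a ad; apply: Fa => b ba; apply: IH.
  exact: leq_trans ba ad.
apply/matrixP => i j; apply: frakR_ext => a; rewrite mxE Defs.coef0.
by have /matrixP/(_ i j) := F0 _ a (leqnn _); rewrite !mxE.
Qed.

Lemma map_at0_resolvent N (A : 'M[frakR R]_N) z :
  \det (1%:M - z *: map_mx at0 A) != 0 ->
  map_mx at0 (invmx (1%:M - cst z *: A)) = invmx (1%:M - z *: map_mx at0 A).
Proof.
move=> dz; have Mu := resolvent_unit dz.
have Mz : map_mx at0 (1%:M - cst z *: A) = 1%:M - z *: map_mx at0 A.
  by rewrite map_mxB map_mx1 map_mxZ [X in X *: _]at0_cst.
have zu : 1%:M - z *: map_mx at0 A \in unitmx by rewrite unitmxE unitfE.
rewrite -[LHS](mulKmx zu) -{2}Mz.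
by rewrite -map_mxM mulmxV // map_mx1 mulmx1.
Qed.

Lemma map_at0_exp N (A : 'M[frakR R]_N) k :
  map_mx at0 (A ^+ k) = map_mx at0 A ^+ k.
Proof.
elim: k => [|k IH]; first by rewrite !expr0 map_mx1.
by rewrite !exprS map_mxM IH.
Qed.

End LowestTerm.

Lemma frakR_controllable_at0 (R : realType) (N p q : nat)
    (H : realization (frakR R) N p q) :
  controllable (realization_at0 H) -> frakR_controllable H.
Proof.
move=> cH f fH; apply: coefmx_eq0 => a fa.
apply: (controllable_mulmx_eq0 cH) => k.
apply: (@resolvent_vanish_markov R[i] _ _ _ _ k _ 1); first exact: oner_neq0.
move=> z _ dz; have := congr1 (coefmx a) (fH z dz).
rewrite -mulmxA coefmx_mulr // map_mxM map_at0_resolvent // mulmxA /= => ->.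
by apply/matrixP => i j; rewrite !mxE Defs.coef0.
Qed.

Lemma observable_at0 (R : realType) (N p q : nat)
    (H : realization (frakR R) N p q) :
  observable (realization_at0 H) -> observable H.
Proof.
move=> oH f g fg; apply/eqP; rewrite -subr_eq0; apply/eqP.
apply: coefmx_eq0 => a fga; apply: oH; apply/funext => k.
rewrite mulmx0 /= -map_at0_exp -map_mxM -coefmx_mull // mulmxBr.
rewrite [X in X - _](congr1 (fun F => F k) fg) subrr.
by apply/matrixP => i j; rewrite !mxE Defs.coef0.
Qed.

Theorem theorem6p6 (R : realType) (N p q : nat)
    (A : 'M[frakR R]_N) (B : 'M[frakR R]_(N, q))
    (C : 'M[frakR R]_(p, N)) (D : 'M[frakR R]_(p, q)) :
  let H : realization (frakR R) N p q := Realization A B C D in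
  (controllable (realization_at0 H) -> frakR_controllable H) /\
  (minimal (realization_at0 H) -> frakR_minimal H).
Proof.
move=> H; split=> [|[cH oH]]; first exact: frakR_controllable_at0.
by split; [apply: observable_at0 | apply: frakR_controllable_at0].
Qed.
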